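(* Let $X$ be the set of points (a metric space). Given any Markov chain $\mathcal M=(S,P)$ with finite non-empty state space $S\subseteq X$ and transition matrix $P$, there exists a Markov Trace Model $\mathcal D$ (with traces over $X$) such that $Ker(\mathcal D)=\mathcal M$, i.e. the Kernel of $\mathcal D$ has state space $S$ and transition probabilities $P$.
   Context: A trace is a finite sequence $T=(T(0),\dots,T(|T|-1))$ of at least two points of $X$ (not necessarily distinct), with $T_{start}=T(0)$ and $T_{end}=T(|T|-1)$. For a set of traces $\mathcal T$: $\mathcal T^{\mathrm{out}}(u)=\{T\in\mathcal T: T_{start}=u\}$, $\mathcal T(u,v)=\{T\in\mathcal T: T_{start}=u,\ T_{end}=v\}$, $P(\mathcal T)=\{u\in X:\mathcal T^{\mathrm{out}}(u)\ne\emptyset\}$. $\mathcal T$ is endless if for every $T\in\mathcal T$ there is $T'\in\mathcal T$ with $T'_{start}=T_{end}$. A Markov Trace Model (MTM) is a pair $\mathcal D=(\mathcal T,\Psi)$ where $\mathcal T$ is an endless set of traces with $|P(\mathcal T)|<\infty$ and $\Psi=\{\psi_u\}_{u\in P(\mathcal T)}$ with $\psi_u$ a (discrete) probability distribution over $\mathcal T^{\mathrm{out}}(u)$. The Kernel $Ker(\mathcal D)$ is the Markov chain with state space $P(\mathcal T)$ and transition probabilities $\Pr(u\to v)=\sum_{T\in\mathcal T(u,v)}\psi_u(T)$ (an empty sum being $0$). *)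

(* Defs.v *)
From HB Require Import structures.
From mathcomp Require Import all_boot all_order all_algebra.
From mathcomp Require Import all_classical all_reals topology ereal esum.

Set Implicit Arguments.
Unset Strict Implicit.
Unset Printing Implicit Defensive.

Import Order.TTheory GRing.Theory Num.Theory.
Local Open Scope classical_set_scope.
Local Open Scope ring_scope.
Local Open Scope ereal_scope.

(* Discrete probability distributions on an arbitrary choiceType: the weights
   may be supported on any countable set, hence the unordered sum \esum. *)
Record discrete_distr (R : realType) (A : choiceType) := DiscreteDistr {
  mass :> A -> R ;
  mass_ge0 : forall a, (0 <= mass a)%R ;
  mass_sum1 : \esum_(a in [set: A]) (mass a)%:E = 1 }.

Record markov_chain (R : realType) (X : metricType R) := MarkovChain {
  state : set X ;
  trans : state -> state -> R ;
  trans_ge0 : forall u v, (0 <= trans u v)%R ;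
  trans_sum1 : forall u, \esum_(v in [set: state]) (trans u v)%:E = 1 }.

(* The pair (n, t) is a trace T with |T| = n + 2 and T(i) = tnth t i. *)
Definition trace (R : realType) (X : metricType R) := {n : nat & n.+2.-tuple X}.

Section Traces.
Context {R : realType} {X : metricType R}.
Implicit Types (Ts : set (trace X)) (u v : X).

Definition trace_start (T : trace X) : X := tnth (tagged T) ord0.

Definition trace_end (T : trace X) : X := tnth (tagged T) ord_max.

Definition traces_out Ts u : set (trace X) :=
  [set T | Ts T /\ trace_start T = u].

Definition traces_between Ts u v : set (trace X) :=
  [set T | [/\ Ts T, trace_start T = u & trace_end T = v]].

Definition start_points Ts : set X := [set u | traces_out Ts u !=set0].

Definition endless Ts : Prop :=
  forall T, Ts T -> exists2 T', Ts T' & trace_start T' = trace_end T.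

End Traces.

Record markov_trace_model (R : realType) (X : metricType R) :=
  MarkovTraceModel {
  traces : set (trace X) ;
  traces_endless : endless traces ;
  finite_start_points : finite_set (start_points traces) ;
  trace_distr : forall u : start_points traces,
    discrete_distr R (traces_out traces (val u)) }.

Section Kernel.
Context {R : realType} {X : metricType R}.
Context (D : markov_trace_model X).

Local Notation S := (start_points (traces D)).

(* traces_between is a subset of traces_out, seen here as a set over the
   subtype on which the distribution lives. *)
Definition kernel_trans_ereal (u v : S) : \bar R :=
  \esum_(T in [set T : traces_out (traces D) (val u) |
                traces_between (traces D) (val u) (val v) (val T)])
    (trace_distr u T)%:E.

(* The sum is at most 1, so that fine loses nothing (see kernel_transE). *)
Definition kernel_trans (u v : S) : R := fine (kernel_trans_ereal u v).

Lemma kernel_trans_ereal_ge0 u v : 0 <= kernel_trans_ereal u v.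
Proof. by apply: esum_ge0 => T _; rewrite lee_fin mass_ge0. Qed.

Lemma trace_end_start_points (T : trace X) :
  traces D T -> trace_end T \in S.
Proof.
move=> /(@traces_endless _ _ D) [T' DT' T'T].
by rewrite inE; exists T'; split.
Qed.

Lemma traces_out_sub u (T : traces_out (traces D) u) : traces D (val T).
Proof. by case: (set_mem (valP T)). Qed.

Lemma kernel_trans_ereal_sum1 u :
  \esum_(v in [set: S]) kernel_trans_ereal u v = 1.
Proof.
rewrite -(mass_sum1 (trace_distr u)) /kernel_trans_ereal.
rewrite esum_esum; last by move=> *; rewrite lee_fin mass_ge0.
pose endp (T : traces_out (traces D) (val u)) : S :=
  Sub (trace_end (val T)) (trace_end_start_points (traces_out_sub T)).
rewrite (@reindex_esum R _ _ [set: _] _ (fun T => (endp T, T)))//; split.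
- move=> T _; split => //=; split => //; first exact: traces_out_sub.
  by case: (set_mem (valP T)).
- by move=> T T' _ _ [].
- move=> [v T] [_ /= [_ _ Tv]]; exists T => //; congr pair.
  exact/val_inj.
Qed.

Lemma kernel_trans_ereal_le1 u v : kernel_trans_ereal u v <= 1.
Proof.
rewrite -(kernel_trans_ereal_sum1 u); apply: esum_ge.
exists [set v]; first by split => //; exact: finite_set1.
by rewrite fsbig_set1.
Qed.

Lemma kernel_transE u v : (kernel_trans u v)%:E = kernel_trans_ereal u v.
Proof.
rewrite /kernel_trans fineK// ge0_fin_numE ?kernel_trans_ereal_ge0//.
exact: le_lt_trans (kernel_trans_ereal_le1 u v) (ltry _).
Qed.

Lemma kernel_trans_ge0 u v : (0 <= kernel_trans u v)%R.
Proof. by rewrite fine_ge0// kernel_trans_ereal_ge0. Qed.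

Lemma kernel_trans_sum1 u : \esum_(v in [set: S]) (kernel_trans u v)%:E = 1.
Proof.
rewrite -[RHS](kernel_trans_ereal_sum1 u).
by apply: eq_esum => v _; rewrite kernel_transE.
Qed.

Definition Ker : markov_chain X :=
  MarkovChain kernel_trans_ge0 kernel_trans_sum1.

End Kernel.

(* Main.v *)
Require Import Defs.
From HB Require Import structures.
From mathcomp Require Import all_boot all_order all_algebra.
From mathcomp Require Import all_classical all_reals topology ereal esum.

Set Implicit Arguments.
Unset Strict Implicit.
Unset Printing Implicit Defensive.

Import Order.TTheory GRing.Theory Num.Theory.

Local Open Scope classical_set_scope.
Local Open Scope ring_scope.
Local Open Scope ereal_scope.

(* A Markov chain is realized by the two-point traces (x, y), x, y in S, with
   psi_x(x, y) := P(x, y): the only trace from u to v is then (u, v), so the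
   kernel sums have a single term. *)

(** For a fixed state x, the map y -> (x, y) is a bijection from S onto the edge traces leaving x.
    The row P(x, -), carried along it, is therefore a probability distribution ([edge_mass_sum1]).
    The trace (y, y) continues any trace ending at y, and it makes every state y a start point, so
    the kernel has state space S. [Ker_edge_model] then compares transition probabilities through
    [markov_chain_eq]. *)

Lemma markov_chain_eq (R : realType) (X : metricType R)
    (M N : markov_chain X) :
  state M = state N ->
  (forall (u v : state M) (u' v' : state N), val u = val u' ->
    val v = val v' -> trans u v = trans u' v') ->
  M = N.
Proof.
(* The type of [trans] depends on the state set, so [p] and [q] become comparable only once the
   state sets are identified. *)
case: M N => [S p p0 p1] [S' q q0 q1] /= ES; case: S' / ES q q0 q1 => q q0 q1.
move=> Epq; have {}Epq : p = q.
  by apply/funext => u; apply/funext => v; exact: Epq.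
case: q / Epq q0 q1 => q0 q1.
by rewrite (Prop_irrelevance p0 q0) (Prop_irrelevance p1 q1).
Qed.

Section EdgeTraces.
Context {R : realType} {X : metricType R}.
Implicit Types (S : set X) (x y : X).

Definition edge x y : trace X := existT _ 0%N [tuple x; y].

(** Pairs of transition probability 0 are kept, so the set of traces depends on S alone. *)
Definition edge_traces S : set (trace X) :=
  [set T | exists x y, [/\ S x, S y & T = edge x y]].

Lemma edge_tracesE {S} {T : trace X} : edge_traces S T ->
  T = edge (trace_start T) (trace_end T).
Proof. by move=> [x [y [_ _ ->]]]. Qed.

Lemma trace_start_edge_traces {S} {T : trace X} :
  edge_traces S T -> trace_start T \in S.
Proof. by move=> [x [y [Sx _ ->]]]; rewrite inE. Qed.

Lemma trace_end_edge_traces {S} {T : trace X} :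
  edge_traces S T -> trace_end T \in S.
Proof. by move=> [x [y [_ Sy ->]]]; rewrite inE. Qed.

Lemma endless_edge_traces S : endless (edge_traces S).
Proof.
move=> T [x [y [Sx Sy ->]]]; exists (edge y y) => //.
by exists y, y.
Qed.

Lemma start_points_edge_traces S : start_points (edge_traces S) = S.
Proof.
apply/seteqP; split => [u [T [ST <-]]|u Su].
  exact/set_mem/(trace_start_edge_traces ST).
by exists (edge u u); split => //; exists u, u.
Qed.

End EdgeTraces.

Section EdgeModel.
Context {R : realType} {X : metricType R}.
Context (M : markov_chain X).
Local Notation S := (state M).
Local Notation Ts := (edge_traces S).

Lemma traces_out_mem {Us : set (trace X)} {u : X} (T : traces_out Us u) :
  Us (val T).
Proof. by case: (set_mem (valP T)). Qed.

(** Both endpoints are read off [T], with [u] a bare point of X, so that the same mass serves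
    whether [u] comes from S or from [start_points Ts]. *)
Definition edge_mass (u : X) (T : traces_out Ts u) : R :=
  trans (Sub (trace_start (val T)) (trace_start_edge_traces (traces_out_mem T)))
        (Sub (trace_end (val T)) (trace_end_edge_traces (traces_out_mem T))).

Lemma edge_massE (u : X) (T : traces_out Ts u) (x y : S) :
  trace_start (val T) = val x -> trace_end (val T) = val y ->
  edge_mass T = trans x y.
Proof. by move=> Tx Ty; congr (trans _ _); apply: val_inj. Qed.

Lemma edge_mass_ge0 (u : X) (T : traces_out Ts u) : (0 <= edge_mass T)%R.
Proof. exact: trans_ge0. Qed.

Lemma edge_out (u v : S) : edge (val u) (val v) \in traces_out Ts (val u).
Proof.
rewrite inE; split => //.
by exists (val u), (val v); split => //; exact: set_mem (valP _).
Qed.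

Lemma edge_mass_sum1 (u : S) :
  \esum_(T in [set: traces_out Ts (val u)]) (edge_mass T)%:E = 1.
Proof.
rewrite -(trans_sum1 u).
pose e (v : S) : traces_out Ts (val u) :=
  Sub (edge (val u) (val v)) (edge_out u v).
rewrite (reindex_esum [set: S] _ e).
  by apply: eq_esum => v _; rewrite (@edge_massE _ _ u v).
split => //.
- by move=> v w _ _ /(congr1 (@trace_end _ _ \o val)) /= /val_inj.
- move=> T _; have [TsT Tu] := set_mem (valP T).
  exists (Sub (trace_end (val T)) (trace_end_edge_traces TsT)) => //.
  by apply: val_inj; rewrite /= [RHS](edge_tracesE TsT) Tu.
Qed.

(** [start_points Ts] equals S only propositionally, so the point is repackaged as a state; the sum
    sees only [val u]. *)
Lemma edge_mass_sum1_start_points (u : start_points Ts) :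
  \esum_(T in [set: traces_out Ts (val u)]) (edge_mass T)%:E = 1.
Proof.
have Su : val u \in S.
  by case: u => x /=; rewrite start_points_edge_traces.
exact: (edge_mass_sum1 (Sub (val u) Su)).
Qed.

Definition edge_distr (u : start_points Ts) :
    discrete_distr R (traces_out Ts (val u)) :=
  DiscreteDistr (@edge_mass_ge0 (val u)) (edge_mass_sum1_start_points u).

Context (finM : finite_set S).

Lemma finite_start_points_edge_traces : finite_set (start_points Ts).
Proof. by rewrite start_points_edge_traces. Qed.

Definition edge_model : markov_trace_model X :=
  MarkovTraceModel (@endless_edge_traces R X S)
    finite_start_points_edge_traces edge_distr.

Lemma Ker_edge_model : Ker edge_model = M.
Proof.
apply: markov_chain_eq => [|u v u' v' uu' vv'].
  exact: start_points_edge_traces.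
(* Passing to extended reals removes the [fine] from the kernel. *)
apply: EFin_inj; rewrite kernel_transE /kernel_trans_ereal.
have Euv : edge (val u) (val v) \in traces_out Ts (val u).
  by rewrite uu' vv' edge_out.
(* An edge trace is determined by its endpoints, so the sum has one term. *)
rewrite (_ : [set T | _] = [set Sub (edge (val u) (val v)) Euv]).
  rewrite esum_set1; last by rewrite lee_fin mass_ge0.
  by congr _%:E; exact: edge_massE.
apply/seteqP; split => [T [TsT Tu Tv]|_ ->].
  by apply: val_inj; rewrite /= (edge_tracesE TsT) Tu Tv.
by split => //; case: (set_mem Euv).
Qed.

End EdgeModel.

Theorem proposition3 (R : realType) (X : metricType R) (M : markov_chain X)
  (finM : finite_set (state M)) (neM : state M !=set0) :
  exists D : markov_trace_model X, Ker D = M.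
Proof. by exists (edge_model finM); exact: Ker_edge_model. Qed.
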